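(* If $D$ is a Krull domain which is also a $\star$-domain, then the local class group $G(D)$ of $D$ has no element of order two.
   Context: A domain $D$ is called a $\star$-domain if $a^2D\cap b^2D=(aD\cap bD)^2$ for every $a,b\in D$. For a nonzero fractional ideal $I$ of a domain $D$ with quotient field $K$, $I^{-1}=\{x\in K\mid xI\subseteq D\}$ and $I_v=(I^{-1})^{-1}$ is its divisorial closure; $I$ is divisorial if $I=I_v$. For a Krull domain $D$, $Div(D)$ is the group of divisorial fractional ideals of $D$ under the $v$-multiplication $(I,J)\mapsto (IJ)_v$. The local class group $G(D)$ is the factor group of $Div(D)$ modulo the subgroup of invertible fractional ideals. *)

(* Defs.v *)
From HB Require Import structures.
From mathcomp Require Import all_boot all_order all_algebra.
From mathcomp Require Import generic_quotient fraction ring_quotient.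
From mathcomp Require Import boolp classical_sets cardinality.

Set Implicit Arguments.
Unset Strict Implicit.
Unset Printing Implicit Defensive.

Import Order.TTheory GRing.Theory Num.Theory.
Local Open Scope classical_set_scope.
Local Open Scope ring_scope.

Definition ideal_mul (R : comNzRingType) (A B : set R) : set R :=
  [set x | exists2 s : seq (R * R),
     (forall p, p \in s -> A p.1 /\ B p.2) & x = \sum_(p <- s) p.1 * p.2].

Definition principal (R : comNzRingType) (a : R) : set R :=
  [set a * x | x in [set: R]].

Definition star_domain (D : idomainType) : Prop :=
  forall a b : D,
    principal (a ^+ 2) `&` principal (b ^+ 2) =
    ideal_mul (principal a `&` principal b) (principal a `&` principal b).

Definition prime_ideal (D : idomainType) (P : {pred D}) : Prop :=
  idealr_closed P /\ prime_idealr_closed P.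

Definition nonzero_pred (D : idomainType) (P : {pred D}) : Prop :=
  exists2 x, x \in P & x != 0.

Definition height_one_prime (D : idomainType) (P : {pred D}) : Prop :=
  [/\ prime_ideal P, nonzero_pred P &
      forall Q : {pred D}, prime_ideal Q -> nonzero_pred Q ->
        {subset Q <= P} -> Q =i P].

Definition localization (D : idomainType) (P : {pred D}) : set {fraction D} :=
  [set x | exists a s : D, s \notin P /\ x = tofrac a / tofrac s].

(* The value [v 0] is irrelevant (it stands for infinity). *)
Definition discrete_valuation (K : fieldType) (v : K -> int) : Prop :=
  [/\ forall x y, x != 0 -> y != 0 -> v (x * y) = v x + v y,
      forall x y, x != 0 -> y != 0 -> x + y != 0 ->
        Num.min (v x) (v y) <= v (x + y) &
      forall n : int, exists2 x, x != 0 & v x = n].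

Definition discrete_valuation_ring (K : fieldType) (V : set K) : Prop :=
  exists2 v : K -> int, discrete_valuation v &
    V = [set x | x != 0 -> 0 <= v x].

(* The definition of a Krull domain in Kaplansky, Commutative Rings. If there is
   no height-one prime, the empty intersection is the whole fraction field. *)
Definition krull_domain (D : idomainType) : Prop :=
  [/\ forall P : {pred D}, height_one_prime P ->
        discrete_valuation_ring (localization P),
      range (@tofrac D) =
        \bigcap_(P in [set P : {pred D} | height_one_prime P]) localization P &
      forall a : D, a != 0 ->
        finite_set [set P : {pred D} | height_one_prime P /\ a \in P]].

(* Fractional ideals are nonzero by definition. *)
Definition fractional_ideal (D : idomainType) (I : set {fraction D}) : Prop :=
  [/\ forall (a : D) x y, I x -> I y -> I (tofrac a * x + y),
      exists2 x, I x & x != 0 &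
      exists2 d : D, d != 0 & forall x, I x -> range (@tofrac D) (tofrac d * x)].

Definition inv_ideal (D : idomainType) (I : set {fraction D}) :
    set {fraction D} :=
  [set x | forall y, I y -> range (@tofrac D) (x * y)].

Definition v_closure (D : idomainType) (I : set {fraction D}) :
    set {fraction D} :=
  inv_ideal (inv_ideal I).

Definition divisorial (D : idomainType) (I : set {fraction D}) : Prop :=
  fractional_ideal I /\ v_closure I = I.

Definition invertible (D : idomainType) (I : set {fraction D}) : Prop :=
  fractional_ideal I /\
  exists2 J, fractional_ideal J & ideal_mul I J = range (@tofrac D).

Definition v_mul (D : idomainType) (I J : set {fraction D}) :
    set {fraction D} :=
  v_closure (ideal_mul I J).

Section FractionalIdeals.
Variable D : idomainType.
Local Notation K := {fraction D}.
Local Notation Dk := (range (@tofrac D)).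
Implicit Types (I J A B C : set K).

Lemma Dk_tofrac a : Dk (tofrac a). Proof. by exists a. Qed.

Lemma Dk_mul x y : Dk x -> Dk y -> Dk (x * y).
Proof. by move=> [a _ <-] [b _ <-]; exists (a * b); rewrite ?tofracM. Qed.

Lemma Dk_add x y : Dk x -> Dk y -> Dk (x + y).
Proof. by move=> [a _ <-] [b _ <-]; exists (a + b); rewrite ?tofracD. Qed.

Lemma Dk_0 : Dk 0. Proof. by exists 0; rewrite ?tofrac0. Qed.

Lemma Dk_1 : Dk 1. Proof. by exists 1; rewrite ?tofrac1. Qed.

Lemma fractional_Dk : fractional_ideal Dk.
Proof.
split.
- by move=> a x y Dx Dy; apply: Dk_add => //; apply: Dk_mul.
- by exists 1; [exact: Dk_1 | exact: oner_neq0].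
- by exists 1; [exact: oner_neq0 | move=> x; rewrite tofrac1 mul1r].
Qed.

Lemma fractional0 A : fractional_ideal A -> A 0.
Proof.
move=> [clA [x Ax _] _]; suff -> : 0 = tofrac (-1) * x + x :> K by exact: clA.
by rewrite tofracN tofrac1 mulN1r addNr.
Qed.

Lemma fractionalM A a x : fractional_ideal A -> A x -> A (tofrac a * x).
Proof.
by move=> fA Ax; rewrite -[_ * x]addr0; case: (fA) => clA _ _; apply: clA => //;
  exact: fractional0.
Qed.

Lemma fractional_sum A (T : eqType) (s : seq T) (F : T -> K) :
  fractional_ideal A -> (forall i, i \in s -> A (F i)) -> A (\sum_(i <- s) F i).
Proof.
move=> fA; have [clA _ _] := fA; elim: s => [|i s IHs] AF.
  by rewrite big_nil; exact: fractional0.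
rewrite big_cons -[F i]mul1r -tofrac1; apply: clA; first exact: AF (mem_head _ _).
by apply: IHs => j js; apply: AF; rewrite inE js orbT.
Qed.

Lemma ideal_mul_in A B x y : A x -> B y -> ideal_mul A B (x * y).
Proof.
move=> Ax By; exists [:: (x, y)]; last by rewrite big_seq1.
by move=> p; rewrite inE => /eqP ->.
Qed.

Lemma ideal_mul_sub A B C : fractional_ideal C ->
  (forall x y, A x -> B y -> C (x * y)) -> ideal_mul A B `<=` C.
Proof.
by move=> fC h x [s hs ->]; apply: fractional_sum => // p /hs[]; exact: h.
Qed.

Lemma ideal_mulC A B : ideal_mul A B = ideal_mul B A.
Proof.
suff sub A' B' : ideal_mul A' B' `<=` ideal_mul B' A' by apply/seteqP; split.
move=> x [s hs ->]; exists [seq (p.2, p.1) | p <- s].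
  by move=> _ /mapP[p /hs[? ?] ->].
by rewrite big_map; apply: eq_bigr => p _; rewrite mulrC.
Qed.

Lemma fractional_mul A B :
  fractional_ideal A -> fractional_ideal B -> fractional_ideal (ideal_mul A B).
Proof.
move=> fA fB; have [_ [x Ax x0] [d d0 dA]] := fA.
have [_ [y By y0] [e e0 eB]] := fB; split.
- move=> a _ _ [s hs ->] [t ht ->].
  exists ([seq (tofrac a * p.1, p.2) | p <- s] ++ t).
    move=> p; rewrite mem_cat => /orP[|/ht //] /mapP[q /hs[Aq Bq] ->]; split=> //=.
    exact: fractionalM.
  rewrite big_cat big_map /= big_distrr /=; congr (_ + _).
  by apply: eq_bigr => p _; rewrite mulrA.
- by exists (x * y); [exact: ideal_mul_in | rewrite mulf_neq0].
- exists (d * e); first by rewrite mulf_neq0.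
  move=> _ [s hs ->]; rewrite big_distrr /=.
  apply: (fractional_sum fractional_Dk) => p /hs[Ap Bp].
  by rewrite tofracM mulrACA; apply: Dk_mul; [exact: dA | exact: eB].
Qed.

Lemma fractional_inv I : fractional_ideal I -> fractional_ideal (inv_ideal I).
Proof.
move=> [clI [x Ix x0] [d d0 dI]]; split.
- move=> a y z hy hz w Iw; rewrite mulrDl -mulrA; apply: Dk_add (hz _ Iw).
  by apply: Dk_mul (hy _ Iw).
- by exists (tofrac d); rewrite ?tofrac_eq0.
- have [e _ eE] := dI x Ix; exists e; last first.
    move=> y hy; rewrite eE -mulrA [x * y]mulrC.
    by apply: Dk_mul (hy _ Ix).
  by rewrite -tofrac_eq0 eE mulf_neq0 // tofrac_eq0.
Qed.

Lemma fractional_v I : fractional_ideal I -> fractional_ideal (v_closure I).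
Proof. by move=> fI; do 2!apply: fractional_inv. Qed.

Lemma sub_v I : I `<=` v_closure I.
Proof. by move=> x Ix y /(_ x Ix); rewrite mulrC. Qed.

Lemma inv_ideal_anti I J : I `<=` J -> inv_ideal J `<=` inv_ideal I.
Proof. by move=> IJ x hx y /IJ; exact: hx. Qed.

Lemma inv_v I : inv_ideal (v_closure I) = inv_ideal I.
Proof.
by apply/seteqP; split; [apply/inv_ideal_anti/sub_v | exact: sub_v].
Qed.

Lemma divisorial_inv I : fractional_ideal I -> divisorial (inv_ideal I).
Proof. by move=> fI; split; [exact: fractional_inv | exact: inv_v]. Qed.

Lemma divisorial_v I : fractional_ideal I -> divisorial (v_closure I).
Proof. by move=> fI; apply/divisorial_inv/fractional_inv. Qed.

Lemma inv_mulP A B x :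
  inv_ideal (ideal_mul A B) x <-> forall a b, A a -> B b -> Dk (x * (a * b)).
Proof.
split=> [h a b Aa Bb|h _ [s hs ->]]; first exact/h/ideal_mul_in.
rewrite big_distrr; apply: (fractional_sum fractional_Dk) => p /hs[].
exact: h.
Qed.

Lemma inv_mul_v A B : inv_ideal (ideal_mul (v_closure A) B) =
  inv_ideal (ideal_mul A B).
Proof.
apply/seteqP; split=> x /inv_mulP h; apply/inv_mulP => a b Aa Bb.
  by apply: h => //; exact: sub_v.
rewrite mulrA mulrAC mulrC; apply: Aa => c Ac.
by rewrite -mulrA [b * c]mulrC; exact: h.
Qed.

Lemma inv_mulA A B C : inv_ideal (ideal_mul A (ideal_mul B C)) =
  inv_ideal (ideal_mul (ideal_mul A B) C).
Proof.
apply/seteqP; split=> x /inv_mulP h; apply/inv_mulP.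
- move=> u c hu Cc; rewrite [u * c]mulrC mulrA.
  move: u hu; apply/inv_mulP => a b Aa Bb.
  rewrite -mulrA [c * _]mulrC -mulrA; apply: h => //; exact: ideal_mul_in.
- move=> a u Aa hu; rewrite mulrA.
  move: u hu; apply/inv_mulP => b c Bb Cc.
  rewrite -mulrA [a * _]mulrA; apply: h => //; exact: ideal_mul_in.
Qed.

Lemma v_mulC I J : v_mul I J = v_mul J I.
Proof. by rewrite /v_mul ideal_mulC. Qed.

Lemma v_mulA I J L : v_mul I (v_mul J L) = v_mul (v_mul I J) L.
Proof.
rewrite /v_mul {1}/v_closure [ideal_mul I _]ideal_mulC inv_mul_v.
by rewrite ideal_mulC inv_mulA -inv_mul_v.
Qed.

Lemma inv_Dk : inv_ideal Dk = Dk.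
Proof.
apply/seteqP; split=> x; first by move=> /(_ 1 Dk_1); rewrite mulr1.
by move=> Dx y Dy; exact: Dk_mul.
Qed.

Lemma divisorial_Dk : divisorial Dk.
Proof. by split; [exact: fractional_Dk | rewrite /v_closure !inv_Dk]. Qed.

Lemma mul_Dk I : fractional_ideal I -> ideal_mul Dk I = I.
Proof.
move=> fI; apply/seteqP; split=> [|x Ix].
  apply: ideal_mul_sub => // _ y [a _ <-] Iy.
  exact: fractionalM.
by rewrite -[x]mul1r; apply: ideal_mul_in => //; exact: Dk_1.
Qed.

Lemma v_mul_Dk I : divisorial I -> v_mul Dk I = I.
Proof. by move=> [fI vI]; rewrite /v_mul mul_Dk. Qed.

Lemma ideal_mulA A B C :
  ideal_mul A (ideal_mul B C) = ideal_mul (ideal_mul A B) C.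
Proof.
suff sub A' B' C' :
    ideal_mul A' (ideal_mul B' C') `<=` ideal_mul (ideal_mul A' B') C'.
  apply/seteqP; split; first exact: sub.
  rewrite ideal_mulC [ideal_mul A B]ideal_mulC [ideal_mul A _]ideal_mulC.
  by rewrite [ideal_mul B C]ideal_mulC; exact: sub.
move=> _ [s hs ->]; elim: s hs => [|[a u] s IHs] hs.
  by rewrite big_nil; exists [::]; rewrite ?big_nil.
rewrite big_cons /=.
have [|t ht ->] := IHs; first by move=> p ps; apply: hs; rewrite inE ps orbT.
have [/= Aa [r hr ->]] := hs _ (mem_head _ _).
exists ([seq (a * p.1, p.2) | p <- r] ++ t).
  move=> p; rewrite mem_cat => /orP[|/ht //] /mapP[q /hr[Bq Cq] ->]; split=> //.
  exact: ideal_mul_in.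
rewrite big_cat big_map /= big_distrr /=; congr (_ + _).
by apply: eq_bigr => p _; rewrite mulrA.
Qed.

Lemma invertible_inv I J :
  fractional_ideal I -> fractional_ideal J -> ideal_mul I J = Dk ->
  inv_ideal I = J.
Proof.
move=> fI fJ IJ; apply/seteqP; split=> x; last first.
  by move=> Jx y Iy; rewrite -IJ mulrC; exact: ideal_mul_in.
move=> hx; have : ideal_mul I J 1 by rewrite IJ; exact: Dk_1.
move=> [s hs e1]; rewrite -[x]mulr1 e1 big_distrr /=.
apply: (fractional_sum fJ) => p /hs[Ip Jp]; rewrite mulrA.
by rewrite -(mul_Dk fJ); apply: ideal_mul_in => //; exact: hx.
Qed.

Lemma invertible_divisorial I : invertible I -> divisorial I.
Proof.
move=> [fI [J fJ IJ]]; rewrite -[I](@invertible_inv J) //.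
  exact: divisorial_inv.
by rewrite ideal_mulC.
Qed.

Lemma invertible_Dk : invertible Dk.
Proof.
split; first exact: fractional_Dk.
by exists Dk; [|apply: mul_Dk]; exact: fractional_Dk.
Qed.

Lemma invertible_inv_ideal I : invertible I -> invertible (inv_ideal I).
Proof.
move=> [fI [J fJ IJ]]; rewrite (invertible_inv fI fJ IJ); split=> //.
by exists I; rewrite // ideal_mulC.
Qed.

Lemma invertible_v_mul I J : invertible I -> invertible J ->
  invertible (v_mul I J).
Proof.
move=> [fI [I' fI' II']] [fJ [J' fJ' JJ']].
suff invIJ : invertible (ideal_mul I J).
  by rewrite /v_mul; have [_ ->] := invertible_divisorial invIJ.
split; first exact: fractional_mul.
exists (ideal_mul J' I'); first exact: fractional_mul.
by rewrite -ideal_mulA [ideal_mul J _]ideal_mulA JJ' mul_Dk.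
Qed.

Hypothesis krullD : krull_domain D.

Lemma valuation_expr (v : K -> int) x n : discrete_valuation v -> x != 0 ->
  v (x ^+ n) = v x *+ n.
Proof.
move=> [vM _ _] x0; elim: n => [|n IHn]; last first.
  by rewrite exprS vM ?expf_neq0 // IHn mulrS.
rewrite expr0 mulr0n; apply/eqP; rewrite -(inj_eq (addrI (v 1))).
by rewrite -vM ?oner_neq0 // mulr1 addr0.
Qed.

(* A Krull domain is completely integrally closed. *)
Lemma krull_cic (c x : K) : c != 0 -> (forall n, Dk (c * x ^+ n)) -> Dk x.
Proof.
move=> c0 h; have [dvr DkE _] := krullD.
have [->|x0] := eqVneq x 0; first exact: Dk_0.
rewrite DkE => P /= hP; have [v dv PE] := dvr P hP; rewrite PE => _.
have [vM _ _] := dv; rewrite leNgt; apply/negP => vx.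
have /(_ (`|v c|.+1)%N) hn n : 0 <= v c + v x *+ n.
  rewrite -(valuation_expr n dv x0) -vM ?expf_neq0 //.
  have : localization P (c * x ^+ n) by move: (h n); rewrite DkE => /(_ P hP).
  by rewrite PE; apply; rewrite mulf_neq0 ?expf_neq0.
move: hn; apply/negP; rewrite -ltNge.
have vx1 : v x <= -1 by rewrite -ltzD1 addNr.
apply: (@le_lt_trans _ _ (v c + (-1) *+ `|v c|.+1)).
  by rewrite lerD2l lerMn2r vx1 orbT.
rewrite mulNrn natz subr_lt0.
by rewrite (le_lt_trans (ler_norm _)) // -abszE ltz_nat.
Qed.

Lemma v_mul_inv I : divisorial I -> v_mul (inv_ideal I) I = Dk.
Proof.
move=> [fI _]; rewrite /v_mul /v_closure -[RHS]inv_Dk; congr inv_ideal.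
have fi := fractional_inv fI.
apply/seteqP; split=> x; last first.
  by move=> Dx; apply/inv_mulP => a b ha Ib; apply: Dk_mul => //; exact: ha.
move=> /inv_mulP hx; have [_ [c hc c0] _] := fi.
have [_ [d Id d0] _] := fI.
have stab n : inv_ideal I (x ^+ n * c).
  elim: n => [|n IHn]; first by rewrite expr0 mul1r.
  by move=> y Iy; rewrite exprS -!mulrA [x ^+ n * _]mulrA; exact: hx.
apply: (@krull_cic (c * d)); first by rewrite mulf_neq0.
by move=> n; rewrite mulrAC [c * _]mulrC; apply: stab.
Qed.

End FractionalIdeals.

(* This abelian group is written additively: the sum of two divisorial ideals is
   their v-product, and the zero element is [D] itself. The Krull hypothesis is
   a parameter of the type because the group structure depends on it. *)
Definition Div (D : idomainType) (krullD : krull_domain D) : Type :=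
  {I : set {fraction D} | divisorial I}.

Section DivGroup.
Variables (D : idomainType) (krullD : krull_domain D).
Local Notation DivD := (Div krullD).

Lemma Div_inj (I J : DivD) : sval I = sval J -> I = J.
Proof.
case: I J => [I hI] [J hJ] /= IJ; case: _ / IJ in hJ *.
by congr exist; exact: Prop_irrelevance.
Qed.

Definition Div_zero : DivD := exist _ _ (divisorial_Dk D).

Definition Div_opp (I : DivD) : DivD :=
  exist _ _ (divisorial_inv (proj1 (svalP I))).

Definition Div_add (I J : DivD) : DivD :=
  exist _ (v_mul (sval I) (sval J))
    (divisorial_v (fractional_mul (proj1 (svalP I)) (proj1 (svalP J)))).

Lemma Div_addA : associative Div_add.
Proof. by move=> I J L; apply/Div_inj/v_mulA. Qed.

Lemma Div_addC : commutative Div_add.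
Proof. by move=> I J; apply/Div_inj/v_mulC. Qed.

Lemma Div_add0 : left_id Div_zero Div_add.
Proof. by move=> I; apply/Div_inj/v_mul_Dk/svalP. Qed.

Lemma Div_addN : left_inverse Div_zero Div_opp Div_add.
Proof. by move=> I; apply/Div_inj/(v_mul_inv krullD)/svalP. Qed.

HB.instance Definition _ := gen_eqMixin DivD.
HB.instance Definition _ := gen_choiceMixin DivD.
HB.instance Definition _ :=
  GRing.isZmodule.Build DivD Div_addA Div_addC Div_add0 Div_addN.

Definition Inv : {pred DivD} := fun I => `[< invertible (sval I) >].

Lemma Inv_zmod_closed : zmod_closed Inv.
Proof.
split=> [|I J]; first exact/asboolP/invertible_Dk.
move=> /asboolP iI /asboolP iJ; apply/asboolP.
exact/invertible_v_mul/invertible_inv_ideal.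
Qed.

HB.instance Definition _ := GRing.isZmodClosed.Build DivD Inv Inv_zmod_closed.

End DivGroup.

(* [Quotient.quot S] only needs a subgroup [S] of a zmodType. *)
Definition local_class_group (D : idomainType) (krullD : krull_domain D) :
    zmodType :=
  Quotient.quot (@Inv D krullD : zmodClosed (Div krullD)).

Definition has_order (G : zmodType) (g : G) (n : nat) : Prop :=
  [/\ (0 < n)%N, g *+ n = 0 &
      forall m : nat, (0 < m < n)%N -> g *+ m <> 0].

(* Main.v *)
(* In a Krull domain every divisorial ideal has the form [x^-1 D `&` y^-1 D]:
   for [x] nonzero in [inv_ideal I], finitely many height-one primes are left at
   which [x] does not have the least value, and [y] attains it there. Hence [I]
   is, up to scaling, an intersection [aD `&` bD], so the star property makes the
   ordinary square [I I] divisorial. Then [v_mul I I] is the ordinary square, and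
   a factor of an invertible ideal is invertible. *)
Require Import Defs.
From mathcomp Require Import all_boot all_order all_algebra.
From mathcomp Require Import generic_quotient fraction ring_quotient.
From mathcomp Require Import boolp classical_sets cardinality.

Set Implicit Arguments.
Unset Strict Implicit.
Unset Printing Implicit Defensive.

Import Order.TTheory GRing.Theory Num.Theory.
Local Open Scope classical_set_scope.
Local Open Scope ring_scope.
Local Open Scope quotient_scope.

(** * Local rings at a prime and local generators of fractional ideals *)

Section Localization.
Variables (D : idomainType) (P : {pred D}).
Hypothesis primeP : prime_ideal P.
Local Notation Dk := (range (@tofrac D)).

Lemma prime_ideal0 : 0 \in P. Proof. by case: primeP => -[]. Qed.

Lemma prime_ideal1 : 1 \notin P. Proof. by case: primeP => -[]. Qed.

Lemma prime_idealD a b : a \in P -> b \in P -> a + b \in P.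
Proof.
by case: primeP => -[_ _ clP] _ Pa Pb; rewrite -[a]mul1r; apply: clP.
Qed.

Lemma prime_idealMl a b : b \in P -> a * b \in P.
Proof.
case: primeP => -[P0 _ clP] _ Pb.
by rewrite -[a * b]addr0; apply: clP.
Qed.

Lemma prime_idealM_notin a b : a \notin P -> b \notin P -> a * b \notin P.
Proof.
case: primeP => _ pP nPa nPb; apply/negP => /pP.
by rewrite (negPf nPa) (negPf nPb).
Qed.

Lemma notin_prime_neq0 a : a \notin P -> a != 0.
Proof. by apply: contraNneq => ->; exact: prime_ideal0. Qed.

Lemma notin_tofrac_neq0 a : a \notin P -> tofrac a != 0.
Proof. by rewrite tofrac_eq0; exact: notin_prime_neq0. Qed.

Lemma localization_Dk x : Dk x -> localization P x.
Proof.
move=> [a _ <-]; exists a, 1.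
by rewrite prime_ideal1 tofrac1 divr1.
Qed.

Lemma localization_mul x y :
  localization P x -> localization P y -> localization P (x * y).
Proof.
move=> [a [s [Ps ->]]] [b [t [Pt ->]]]; exists (a * b), (s * t).
by rewrite prime_idealM_notin // !tofracM mulf_div.
Qed.

Lemma localization_inv a s : a \notin P -> localization P (tofrac a / tofrac s)^-1.
Proof. by move=> Pa; exists s, a; rewrite invf_div. Qed.

(** The sum has numerator [c * s + a], which stays outside [P] because [c * s] does and [a] lies in
    [P]; so it is a unit of the local ring. *)
Lemma localization_inv_add c a s : c \notin P -> a \in P -> s \notin P ->
  localization P (tofrac c + tofrac a / tofrac s)^-1 /\
  tofrac c + tofrac a / tofrac s != 0.
Proof.
move=> Pc Pa Ps.
have s0 := notin_tofrac_neq0 Ps.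
have -> : tofrac c + tofrac a / tofrac s = tofrac (c * s + a) / tofrac s.
  by rewrite tofracD tofracM mulrDl mulfK.
have Pn : c * s + a \notin P.
  apply/negP => Pn; have /negP := prime_idealM_notin Pc Ps; apply.
  rewrite -[c * s](addrK a); apply: prime_idealD => //.
  by rewrite -mulN1r; exact: prime_idealMl.
split; first exact: localization_inv.
by rewrite mulf_neq0 ?invr_eq0 ?notin_tofrac_neq0.
Qed.

(** Multiplication by [d] moves [J] into [D], where values are nonnegative, so a least value is
    attained at some [w]; then [x / w] has nonnegative value for all nonzero [x] in [J]. *)
Lemma exists_local_generator (J : set {fraction D}) :
  discrete_valuation_ring (localization P) -> fractional_ideal J ->
  exists w, [/\ J w, w != 0 & forall x, J x -> localization P (x / w)].
Proof.
move=> [v [vM _ _] PE] [_ [w0 Jw0 w0n0] [d d0 dJ]].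
have fd0 : tofrac d != 0 :> {fraction D} by rewrite tofrac_eq0.
have v_ge0 w : J w -> w != 0 -> 0 <= v (tofrac d * w).
  move=> Jw wn0; have : localization P (tofrac d * w).
    exact/localization_Dk/dJ.
  by rewrite PE; apply; rewrite mulf_neq0.
(* The absolute value only turns nonnegative integers into naturals, so that a minimum can be
   taken. *)
pose val_at n := `[< exists w, [/\ J w, w != 0 & `|v (tofrac d * w)%R|%N = n] >].
have exn : exists n, val_at n.
  by exists (`|v (tofrac d * w0)%R|%N); apply/asboolP; exists w0.
case: (ex_minnP exn) => n /asboolP[w [Jw wn0 vw]] leastn.
exists w; split=> // x Jx; rewrite PE /= => xw0.
have x0 : x != 0 by apply: contraNneq xw0 => ->; rewrite mul0r.
have : (n <= `|v (tofrac d * x)%R|)%N.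
  by apply: leastn; apply/asboolP; exists x.
rewrite -vw -lez_nat !gez0_abs ?v_ge0 //.
have -> : tofrac d * x = tofrac d * w * (x / w).
  by rewrite -mulrA [w * _]mulrC divfK.
by rewrite (vM (tofrac d * w)) // ?mulf_neq0 // lerDl.
Qed.

End Localization.

(** * Divisorial ideals of a Krull domain are cut out by two elements *)

Section Krull.
Variable D : idomainType.
Local Notation K := {fraction D}.
Local Notation Dk := (range (@tofrac D)).

Lemma height_one_prime_eq (P Q : {pred D}) :
  height_one_prime P -> height_one_prime Q -> {subset Q <= P} -> Q = P.
Proof.
move=> [_ _ minP] [pQ nQ _] sQP; apply/funext => x.
exact: (minP Q pQ nQ sQP x).
Qed.

(** By minimality of [P], no other height-one prime lies inside it; each [Q] in [s] thus has an
    element outside [P], and [c] is the product of these. *)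
Lemma height_one_separation (P : {pred D}) (s : seq {pred D}) :
  height_one_prime P -> (forall Q, Q \in s -> height_one_prime Q) ->
  P \notin s -> exists2 c, c \notin P & forall Q : {pred D}, Q \in s -> c \in Q.
Proof.
move=> hP; have [pP _ _] := hP.
elim: s => [|Q s IHs] hs; first by exists 1; rewrite ?prime_ideal1.
rewrite inE negb_or => /andP[PQ Ps].
have [R Rs|//|c Pc sc] := IHs; first by apply: hs; rewrite inE Rs orbT.
have hQ := hs Q (mem_head _ _).
have [b Qb Pb] : exists2 b, b \in Q & b \notin P.
  apply: contrapT => nb; move/eqP: PQ; apply; apply/esym.
  apply: height_one_prime_eq => // b Qb; apply/negPn/negP => Pb.
  by apply: nb; exists b.
exists (c * b); first exact: prime_idealM_notin.
move=> R; rewrite inE => /predU1P[->|Rs].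
  by have [pQ _ _] := hQ; apply: prime_idealMl.
have [pR _ _] : height_one_prime R by apply: hs; rewrite inE Rs orbT.
by rewrite mulrC; apply: prime_idealMl => //; exact: sc.
Qed.

Hypothesis krullD : krull_domain D.

(* If [w] generates [J] locally at a new prime [P] and [y] does so at the primes
   of [s], then [y] itself or [y + c w] works for [P :: s], where [c] lies in
   every prime of [s] but not in [P]. *)
Lemma exists_semilocal_generator (J : set K) (s : seq {pred D}) :
  fractional_ideal J -> (forall P, P \in s -> height_one_prime P) ->
  exists y, [/\ J y, y != 0 &
    forall P x, P \in s -> J x -> localization P (x / y)].
Proof.
move=> fJ; have [dvr _ _] := krullD.
elim: s => [|P s IHs] hs; first by case: (fJ) => _ [x Jx x0] _; exists x.
have [|y [Jy y0 sy]] := IHs; first by move=> R Rs; apply: hs; rewrite inE Rs orbT.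
have hP := hs P (mem_head _ _); have [pP _ _] := hP.
have [w [Jw w0 Pw]] := exists_local_generator pP (dvr P hP) fJ.
(* It is enough to compare [y'] with the known generators: [w] at [P] and [y] at the primes of
   [s]. *)
suff [y' [Jy' y'0 Pwy' sy']] : exists y', [/\ J y', y' != 0,
    localization P (w / y') &
    forall Q : {pred D}, Q \in s -> localization Q (y / y')].
  exists y'; split=> // Q x; rewrite inE => /predU1P[->|Qs] Jx.
    have -> : x / y' = x / w * (w / y') by rewrite mulrA divfK.
    by apply: localization_mul => //; exact: Pw.
  have [pQ _ _] : height_one_prime Q by apply: hs; rewrite inE Qs orbT.
  have -> : x / y' = x / y * (y / y') by rewrite mulrA divfK.
  by apply: localization_mul => //; [exact: sy|exact: sy'].
have old : localization P (w / y) -> exists y', [/\ J y', y' != 0,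
    localization P (w / y') &
    forall Q : {pred D}, Q \in s -> localization Q (y / y')].
  by move=> Pwy; exists y; split=> // Q Qs; exact: sy.
have [Ps|Ps] := boolP (P \in s); first exact/old/sy.
have [a [t [Pt ywE]]] := Pw y Jy.
(* Here [y / w = a / t]; if [a] is outside [P], this is a unit at [P] and [y] already generates
   there. *)
have [Pa|Pa] := boolP (a \in P); last first.
  by apply: old; rewrite -invf_div ywE; exact: localization_inv.
have [Q Qs|//|c Pc sc] := height_one_separation hP (s := s).
  by apply: hs; rewrite inE Qs orbT.
have [Pu u0] := localization_inv_add pP Pc Pa Pt.
have yE : tofrac c * w + y = (tofrac c + tofrac a / tofrac t) * w.
  by rewrite -ywE mulrDl divfK.
exists (tofrac c * w + y); split.
- by case: fJ => clJ _ _; exact: clJ.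
- by rewrite yE mulf_neq0.
- by rewrite yE invfM mulrCA mulfV // mulr1.
move=> Q Qs; have [pQ _ _] : height_one_prime Q by apply: hs; rewrite inE Qs orbT.
have [b [r [Qr wyE]]] := sy Q w Qs Jw.
have cb : b * c \in Q by apply: prime_idealMl => //; exact: sc.
have [+ _] := localization_inv_add pQ (prime_ideal1 pQ) cb Qr.
(* Since [w / y = b / r] at [Q], the new element is [y] times [1 + b c / r], a unit because [c] lies
   in [Q]. *)
suff -> : y / (tofrac c * w + y) = (tofrac 1 + tofrac (b * c) / tofrac r)^-1 by [].
rewrite -invf_div; congr _^-1.
rewrite mulrDl divff // addrC tofrac1 tofracM -mulrA.
by rewrite -mulrA wyE mulrCA.
Qed.

Lemma krull_inv_two_generators (J : set K) : fractional_ideal J ->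
  exists x y, [/\ J x, J y, x != 0, y != 0 &
    inv_ideal J = [set z | Dk (z * x) /\ Dk (z * y)]].
Proof.
move=> fJ; have [_ [x Jx x0] [d d0 dJ]] := fJ.
have [_ DkE fin] := krullD.
have [a _ aE] := dJ x Jx.
have a0 : a != 0 by rewrite -tofrac_eq0 aE mulf_neq0 ?tofrac_eq0.
have /finite_seqP[s sE] := fin a a0.
have mem_s P : (P \in s) = ([set` s]%classic P) :> Prop by [].
have [|y [Jy y0 sy]] := @exists_semilocal_generator J s fJ.
  by move=> P; rewrite mem_s -sE => -[].
exists x, y; split=> //; apply/seteqP; split=> [z hz|z [zx zy] w Jw].
  by split; exact: hz.
rewrite DkE => P /= hP; have [pP _ _] := hP.
have [Pa|Pa] := boolP (a \in P).
  have Ps : P \in s by rewrite mem_s -sE.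
  have -> : z * w = z * y * (w / y) by rewrite -mulrA [y * _]mulrC divfK.
  by apply: localization_mul (localization_Dk _ zy) (sy P w Ps Jw).
(* With [a = d x] outside [P], the quotient [w / x = d w / a] is local at [P]. *)
have -> : z * w = z * x * (tofrac d * w / tofrac a).
  by rewrite aE -mulf_div divff ?tofrac_eq0 // mul1r -mulrA [x * _]mulrC divfK.
apply: localization_mul (localization_Dk _ zx) _ => //.
by have [b _ <-] := dJ w Jw; exists b, a.
Qed.

(** * Squares of divisorial ideals under the star property *)

Hypothesis starD : star_domain D.

(* Writing [p/d = e/a] and [q/d = e/b], the ideal [I] is
   [e^-1 (aD `&` bD)], and the star property gives
   [I^2 = e^-2 (a^2 D `&` b^2 D)], which is divisorial. *)
Lemma star_sqr_divisorial (p q d : D) : p != 0 -> q != 0 -> d != 0 ->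
  let I := [set z : K | Dk (z * (tofrac p / tofrac d)) /\
                        Dk (z * (tofrac q / tofrac d))] in
  v_closure (ideal_mul I I) = ideal_mul I I.
Proof.
move=> p0 q0 d0 I.
have fp : tofrac p != 0 :> K by rewrite tofrac_eq0.
have fq : tofrac q != 0 :> K by rewrite tofrac_eq0.
have fd : tofrac d != 0 :> K by rewrite tofrac_eq0.
apply/seteqP; split; last exact: sub_v.
move=> z hz.
(* An [x] in the inverse of [I] has its square in the inverse of [I I], which [z] multiplies into
   [D]. *)
have sqr_inv x : (forall u, I u -> Dk (u * x)) -> Dk (z * (x ^+ 2)).
  move=> hx; apply: hz; apply/inv_mulP => u v Iu Iv.
  by rewrite expr2 mulrACA; apply: Dk_mul; rewrite mulrC; exact: hx.
have [m _ mE] : Dk (z * (tofrac p / tofrac d) ^+ 2) by apply: sqr_inv => u [].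
have [n _ nE] : Dk (z * (tofrac q / tofrac d) ^+ 2) by apply: sqr_inv => u [].
pose a := d * q; pose b := d * p; pose e := p * q.
have fe : tofrac e != 0 :> K by rewrite tofracM mulf_neq0.
have eA : tofrac e = tofrac a * (tofrac p / tofrac d) :> K.
  by rewrite !tofracM mulrACA [tofrac d * _]mulrC mulrACA mulfV // mulr1 mulrC.
have eB : tofrac e = tofrac b * (tofrac q / tofrac d) :> K.
  by rewrite !tofracM mulrACA [tofrac d * _]mulrC mulrACA mulfV // mulr1 mulrC.
have zeA : z * tofrac e ^+ 2 = tofrac (a ^+ 2 * m).
  by rewrite eA exprMn mulrCA -mE tofracM tofracXn.
have zeB : z * tofrac e ^+ 2 = tofrac (b ^+ 2 * n).
  by rewrite eB exprMn mulrCA -nE tofracM tofracXn.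
have [r hr trE] : ideal_mul (principal a `&` principal b)
    (principal a `&` principal b) (a ^+ 2 * m).
  rewrite -starD; split; first by exists m.
  by exists n => //; apply/eqP; rewrite -tofrac_eq -zeA zeB.
(* Division by [e] carries the factors supplied by the star property back into [I]. *)
have inI u : (principal a `&` principal b) u -> I (tofrac u / tofrac e).
  move=> [[k _ kE] [l _ lE]]; split.
    by exists k => //; rewrite -kE tofracM mulrAC [tofrac a * _ * _]mulrAC -eA
      mulrC mulKf.
  by exists l => //; rewrite -lE tofracM mulrAC [tofrac b * _ * _]mulrAC -eB
    mulrC mulKf.
exists [seq (tofrac x.1 / tofrac e, tofrac x.2 / tofrac e) | x <- r].
  by move=> _ /mapP[x /hr[h1 h2] ->]; split; exact: inI.
rewrite big_map /= -[z](@mulfK _ (tofrac e ^+ 2)) ?expf_neq0 // zeA trE.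
rewrite rmorph_sum /= big_distrl /=; apply: eq_bigr => x _.
by rewrite mulf_div tofracM expr2.
Qed.

(** [I] is the inverse of [inv_ideal I], hence cut out by two elements of it, and these share a
    denominator [d]. *)
Lemma star_krull_sqr_divisorial (I : set K) :
  divisorial I -> v_mul I I = ideal_mul I I.
Proof.
move=> [fI vI]; have fJ := fractional_inv fI.
have [x [y [Jx Jy x0 y0 IE]]] := krull_inv_two_generators fJ.
have [_ _ [d d0 dJ]] := fJ.
have fd : tofrac d != 0 :> K by rewrite tofrac_eq0.
have [p _ pE] := dJ x Jx; have [q _ qE] := dJ y Jy.
have num_neq0 r z : z != 0 -> tofrac r = tofrac d * z -> r != 0.
  by move=> z0 rE; rewrite -tofrac_eq0 rE mulf_neq0.
have := star_sqr_divisorial (num_neq0 p x x0 pE) (num_neq0 q y y0 qE) d0.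
rewrite /= pE qE ![tofrac d * _]mulrC !mulfK // -IE.
by rewrite -/(v_closure I) vI.
Qed.

(** If [J] inverts the ordinary product [I I], then [I J] inverts [I] by associativity. *)
Lemma star_krull_invertible_sqrt (I : set K) :
  divisorial I -> invertible (v_mul I I) -> invertible I.
Proof.
move=> dI; rewrite star_krull_sqr_divisorial // => -[_ [J fJ IIJ]].
have [fI _] := dI; split=> //; exists (ideal_mul I J).
  exact: fractional_mul.
by rewrite ideal_mulA.
Qed.

End Krull.

(** * Passage to the local class group *)

Lemma local_class_group_pi_eq0 (D : idomainType) (krullD : krull_domain D)
    (I : Div krullD) :
  \pi_(local_class_group krullD) I = 0 <-> invertible (sval I).
Proof.
rewrite -(raddf0 \pi_(local_class_group krullD)).
rewrite (rwP eqP) -Quotient.idealrBE subr0.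
by split=> [/asboolP|?]; last exact/asboolP.
Qed.

Theorem corollary2p9 (D : idomainType) (krullD : krull_domain D)
  (starD : star_domain D) :
  ~ exists g : local_class_group krullD, has_order g 2.
Proof.
(* Order two excludes [g = 0], the case [m = 1]; yet [g *+ 2 = 0] forces it. *)
move=> [g [_ g2 g1]]; apply: (g1 1%N) => //.
move: g2; rewrite -(reprK g) -!raddfMn => /local_class_group_pi_eq0 inv2.
apply/local_class_group_pi_eq0; rewrite mulr1n.
apply: (star_krull_invertible_sqrt krullD starD) => //; exact: svalP.
Qed.
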